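(* Let $\mathbb{F}$ be a field, let $s,t\in\mathbb{N}$ with $s,t\ge2$, and let $m,n\in\mathbb{N}$ with $n\ge s\cdot t^4$. Then any $m$-fold hyperplane section of $\mathrm{Gr}(n,2)$ either contains $\mathrm{Gr}(W,2)$ for some $s$-dimensional subspace $W\le\mathbb{F}^n$, or intersects $\mathrm{Gr}(W,2)$ trivially for some $t$-dimensional subspace $W\le\mathbb{F}^n$.
   Context: $\mathrm{Gr}(n,2)$ is the Grassmannian of $2$-dimensional subspaces of $\mathbb{F}^n$, and for a subspace $W\le\mathbb{F}^n$, $\mathrm{Gr}(W,2)\subseteq\mathrm{Gr}(n,2)$ is the subvariety of $2$-dimensional subspaces of $\mathbb{F}^n$ contained in $W$. An $m$-fold hyperplane section of $\mathrm{Gr}(n,2)$ is the section defined by an alternating bilinear map $\phi:\mathbb{F}^n\times\mathbb{F}^n\to\mathbb{F}^m$ (bilinear with $\phi(v,v)=0$ for all $v$), namely the set of all $V\in\mathrm{Gr}(n,2)$ such that $\phi(v_1,v_2)=0$ for all $v_1,v_2\in V$ (equivalently, the intersection of $\mathrm{Gr}(n,2)$ in its Plücker embedding with the zero loci of the $m$ linear forms given by the components of $\phi$). Two sets intersect trivially if their intersection is empty. *)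

(* Defs.v *)
From HB Require Import structures.
From mathcomp Require Import all_boot all_algebra.
From mathcomp Require Import classical_sets.

Set Implicit Arguments.
Unset Strict Implicit.
Unset Printing Implicit Defensive.

Import GRing.Theory.
Local Open Scope ring_scope.
Local Open Scope classical_set_scope.

Definition alternating (F : fieldType) (n m : nat)
    (phi : 'rV[F]_n -> 'rV[F]_n -> 'rV[F]_m) : Prop :=
  forall v, phi v v = 0.

(* Gr W k is a set of subspaces of the ambient space vT; the Grassmannian
   Gr(n, k) is Gr fullv k in 'rV[F]_n. *)
Definition Gr (F : fieldType) (vT : vectType F) (W : {vspace vT}) (k : nat) :
    set {vspace vT} :=
  [set V | (V <= W)%VS /\ \dim V = k].

(* The m-fold section of Gr(n, 2) defined by phi; only meant for phi
   bilinear and alternating. *)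
Definition hyperplane_section (F : fieldType) (n m : nat)
    (phi : 'rV[F]_n -> 'rV[F]_n -> 'rV[F]_m) : set {vspace 'rV[F]_n} :=
  [set V | Gr fullv 2 V /\
           forall v1 v2, v1 \in V -> v2 \in V -> phi v1 v2 = 0].

(* Main.v *)
(** Let d = t^3 and suppose that there is no isotropic subspace of dimension s.
    Growing an isotropic subspace greedily inside a subspace X shows that X has
    a subspace Y, of codimension at most sd, such that phi(y, -) has rank at
    least d on X for every nonzero y in Y. Since n >= t * sd, this can be
    iterated, and one builds C of dimension 1, 2, ..., t while climbing back along the
    resulting chain: the nonzero elements of C, being in Y, have a large rank on
    X, so that X contains a v for which c |-> phi(c, v) is injective on C modulo
    the span of phi(C, C), and then phi vanishes on no plane of C + <v> if it
    vanishes on no plane of C. *)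

Require Import Defs.
From HB Require Import structures.
From mathcomp Require Import all_boot all_algebra.
From mathcomp Require Import boolp classical_sets.
From mathcomp Require Import zify.

Set Implicit Arguments.
Unset Strict Implicit.
Unset Printing Implicit Defensive.

Import GRing.Theory.
Local Open Scope ring_scope.
Local Open Scope classical_set_scope.

Lemma dim_limg_subspace (F : fieldType) (vT zT : vectType F)
    (g : 'Hom(vT, zT)) (U U' : {vspace vT}) : (U' <= U)%VS ->
  (\dim (g @: U) <= \dim (g @: U') + (\dim U - \dim U'))%N.
Proof.
move=> sU'U; have := limg_ker_dim g U; have := limg_ker_dim g U'.
have := dimvS (capvS sU'U (subvv (lker g))); have := dimvS sU'U; lia.
Qed.

Lemma dim_addv_vline (F : fieldType) (vT : vectType F) (U : {vspace vT}) v :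
  v \notin U -> \dim (U + <[v]>) = (\dim U).+1.
Proof.
move=> vNU; rewrite dimv_disjoint_sum ?dim_vline.
  by rewrite (memPnC vNU) ?mem0v ?addn1.
apply/eqP; rewrite -subv0; apply/subvP => z.
rewrite memv_cap => /andP[zU /vlineP[a za]]; move: zU.
by rewrite memv0 za rpredZeq (negPf vNU) orbF => /eqP->; rewrite scale0r.
Qed.

Lemma common_kernel (F : fieldType) (vT zT : vectType F) (D : {vspace zT})
    (gs : seq 'Hom(vT, zT)) (U : {vspace vT}) :
    {in gs, forall g, limg g <= D}%VS ->
  exists2 U' : {vspace vT}, (U' <= U)%VS &
    (\dim U <= \dim U' + size gs * \dim D)%N
    /\ {in gs & U', forall (g : 'Hom(vT, zT)) v, g v = 0}.
Proof.
elim: gs => [|g gs IHgs] sgD; first by exists U; rewrite ?addn0.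
have [h hgs|U' sU'U [dimU' gU']] := IHgs; first by rewrite sgD // mem_behead.
exists (U' :&: lker g)%VS; first exact: subv_trans (capvSl _ _) sU'U.
split=> [|h v].
  have sgU'D : (g @: U' <= D)%VS.
    by apply: subv_trans (limgS g (subvf U')) _; rewrite sgD ?mem_head.
  have := limg_ker_dim g U'; have := dimvS sgU'D; rewrite /= mulSn; lia.
rewrite inE memv_cap memv_ker => hgs /andP[vU' /eqP gv0].
by case/predU1P: hgs => [-> // | hgs]; exact: gU'.
Qed.

(** By linearity in [c] only a basis of [C] matters, and each basis vector costs at most [\dim D]
    dimensions. *)
Lemma annihilator_codim (F : fieldType) (cT vT zT : vectType F)
    (f : {bilinear cT -> vT -> zT})
    (C : {vspace cT}) (U : {vspace vT}) (D : {vspace zT}) :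
  exists2 U' : {vspace vT}, (U' <= U)%VS &
    (\dim U <= \dim U' + \dim C * \dim D)%N
    /\ {in C & U', forall c v, projv D (f c v) = 0}.
Proof.
pose gs := [seq (projv D \o linfun (f c))%VF | c <- vbasis C].
have [_ /mapP[c _ ->]|U' sU'U] := @common_kernel _ _ _ D gs U.
  by rewrite limg_comp -{2}[D]limg_proj limgS ?subvf.
rewrite size_map size_tuple => -[dimU' gU']; exists U' => //; split=> // c v cC vU'.
rewrite -applyrE (coord_vbasis cC) !linear_sum big1 // => i _.
rewrite !linearZ /= -[f _ v](lfunE (f _)) -comp_lfunE.
rewrite gU' ?scaler0 //; apply: map_f; exact/memt_nth.
Qed.

(* The quadratic bound makes the induction work over every field, large or
   small: the witness is a sum [v + w], where [w] takes care of a complement of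
   the kernel [K] of [f ^~ w] in [C], and [v], whose products with [C] have no
   component along [D = f C w], takes care of [K]. Passing to such [v] costs
   [\dim C * \dim D] dimensions, and
   [(\dim C - \dim D) ^ 2 + \dim C * \dim D <= \dim C ^ 2]. *)
Lemma exists_injective_product (F : fieldType) (cT vT zT : vectType F)
    (f : {bilinear cT -> vT -> zT}) (C : {vspace cT}) (U : {vspace vT}) :
    (forall c, c \in C -> c != 0 -> (\dim C ^ 2 <= \dim (linfun (f c) @: U))%N) ->
  exists2 v, v \in U & forall c, c \in C -> f c v = 0 -> c = 0.
Proof.
have [k] := ubnP (\dim C); elim: k => // k IHk in C U *; rewrite ltnS => dimC rkf.
have [C0|C0] := eqVneq C 0%VS.
  by exists 0; [exact: mem0v | move=> c; rewrite C0 memv0 => /eqP].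
have dimC_gt0: (0 < \dim C)%N by rewrite lt0n dimv_eq0.
have [c0 [w [c0C wU fc0w]]] : exists c0 w, [/\ c0 \in C, w \in U & f c0 w != 0].
  have := rkf _ (memv_pick C); rewrite vpick0 => /(_ C0) rk.
  have img0 : (linfun (f (vpick C)) @: U != 0)%VS.
    by rewrite -dimv_eq0 -lt0n (leq_trans _ rk) // expn_gt0 dimC_gt0.
  have /memv_imgP[w wU Ew] := memv_pick (linfun (f (vpick C)) @: U)%VS.
  exists (vpick C), w; split=> //; first exact: memv_pick.
  by rewrite -[f _ w](lfunE (f _)) -Ew vpick0.
pose g := linfun (applyr f w).
have gE c : g c = f c w by rewrite lfunE.
pose K := (C :&: lker g)%VS; pose D := (g @: C)%VS.
have dimKD : (\dim K + \dim D = \dim C)%N := limg_ker_dim g C.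
have dimD : (0 < \dim D)%N.
  rewrite lt0n dimv_eq0; apply: contraNneq fc0w => D0.
  by rewrite -memv0 -D0 -gE memv_img.
have [U' sU'U [dimU' projD]] := annihilator_codim f C U D.
have [||v vU' vK] := IHk K U'; first by lia.
  move=> c; rewrite memv_cap => /andP[cC _] c_neq0.
  have := rkf c cC c_neq0; have := dim_limg_subspace (linfun (f c)) sU'U.
  have := dimvS sU'U; nia.
exists (v + w) => [|c cC]; first by rewrite rpredD // (subvP sU'U).
rewrite linearDr => fc0.
(* [f c w] lies in [D] and [f c v] projects to 0 there, so projecting their zero sum onto [D] leaves
   [f c w]. *)
have fcw0 : f c w = 0.
  have /projv_id <- : f c w \in D by rewrite -gE memv_img.
  by rewrite -[LHS]add0r -[X in X + _](projD c v) // -linearD fc0 linear0.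
apply: vK; first by rewrite memv_cap cC memv_ker gE fcw0 /=.
by move: fc0; rewrite fcw0 addr0.
Qed.

(** On a subspace of [U] whose products with [C] have no component along [E], lying in [E] means
    vanishing; the term [\dim C * \dim E] pays for passing to it. *)
Lemma exists_injective_product_mod (F : fieldType) (cT vT zT : vectType F)
    (f : {bilinear cT -> vT -> zT})
    (C : {vspace cT}) (U : {vspace vT}) (E : {vspace zT}) :
    (forall c, c \in C -> c != 0 ->
       (\dim C ^ 2 + \dim C * \dim E <= \dim (linfun (f c) @: U))%N) ->
  exists2 v, v \in U & forall c, c \in C -> f c v \in E -> c = 0.
Proof.
move=> rkf; have [U' sU'U [dimU' projE]] := annihilator_codim f C U E.
have [c cC c0|v vU' vC] := @exists_injective_product _ _ _ _ f C U'.
  have := rkf c cC c0; have := dim_limg_subspace (linfun (f c)) sU'U.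
  have := dimvS sU'U; lia.
exists v => [|c cC /projv_id fcE]; first exact: (subvP sU'U).
by apply: vC => //; rewrite -fcE projE.
Qed.

Lemma alternating_skew (F : fieldType) (vT zT : vectType F)
    (phi : {bilinear vT -> vT -> zT}) :
  (forall v, phi v v = 0) -> forall u v, phi u v = - phi v u.
Proof.
move=> phi_alt u v; apply/eqP; rewrite -addr_eq0; move/eqP: (phi_alt (u + v)).
by rewrite linearDl !linearDr !phi_alt add0r addr0 => ->.
Qed.

Definition isotropic (F : fieldType) (vT zT : vectType F)
    (phi : vT -> vT -> zT) (U : {vspace vT}) : Prop :=
  {in U &, forall u v, phi u v = 0}.

(** For alternating bilinear [phi]: no plane of [U] is isotropic. *)
Definition anisotropic (F : fieldType) (vT zT : vectType F)
    (phi : vT -> vT -> zT) (U : {vspace vT}) : Prop :=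
  {in U &, forall u v, u != 0 -> phi u v = 0 -> v \in <[u]>%VS}.

(* The isotropic subspace [U] grows inside its annihilator [A] in [X], each new
   vector [y] of [A] costing [\dim (phi y @: X)] dimensions; when no vector of
   [A] outside [U] is cheap, a complement of [U] in [A] is the wanted [Y]. *)
Lemma isotropic_or_high_rank (F : fieldType) (vT zT : vectType F)
    (phi : {bilinear vT -> vT -> zT})
    (X : {vspace vT}) (d s : nat) : (forall v, phi v v = 0) -> (0 < d)%N ->
    (exists2 U : {vspace vT}, \dim U = s & isotropic phi U)
  \/ (exists2 Y : {vspace vT}, (Y <= X)%VS &
       (\dim X <= \dim Y + s * d)%N /\
       forall y, y \in Y -> y != 0 -> (d <= \dim (linfun (phi y) @: X))%N).
Proof.
move=> phi_alt d_gt0.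
(* Cheap vectors cost at most [d.-1] each, which leaves room to remove [U] itself from [A]:
   [s * d.-1 + s = s * d]. *)
suff [[U [A [dimU _ _ Uiso _]]]|[Y sYX [dimY rkY]]] :
    (exists U A : {vspace vT}, [/\ \dim U = s, (U <= A <= X)%VS,
       (\dim X <= \dim A + s * d.-1)%N, isotropic phi U
       & {in U & A, forall u a, phi u a = 0}]) \/
    (exists2 Y : {vspace vT}, (Y <= X)%VS &
       (\dim X <= \dim Y + s * d)%N /\
       forall y, y \in Y -> y != 0 -> (d <= \dim (linfun (phi y) @: X))%N).
- by left; exists U.
- by right; exists Y.
elim: s => [|s [[U [A [dimU /andP[sUA sAX] dimA Uiso UA]]]|[Y sYX [dimY rkY]]]].
- left; exists 0%VS, X; rewrite dimv0 sub0v subvv addn0; split=> // u v;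
    by rewrite memv0 => /eqP->; rewrite linear0l.
- have [[y [yA yU rky]]|no_y] := pselect (exists y,
    [/\ y \in A, y \notin U & (\dim (linfun (phi y) @: X) < d)%N]).
    have Uy u : u \in U -> phi u y = 0 by move=> uU; exact: UA.
    have yUa u : u \in U -> phi y u = 0.
      by move=> uU; rewrite (alternating_skew phi_alt) Uy ?oppr0.
    left; exists (U + <[y]>)%VS, (A :&: lker (linfun (phi y)))%VS; split.
    + by rewrite dim_addv_vline // dimU.
    + rewrite (subv_trans (capvSl _ _)) // andbT subv_add !subv_cap sUA.
      rewrite -!memvE yA memv_ker lfunE /= phi_alt eqxx !andbT.
      by apply/subvP => u uU; rewrite memv_ker lfunE /= yUa.
    + have := limg_ker_dim (linfun (phi y)) A.
      have := dimvS (limgS (linfun (phi y)) sAX); rewrite mulSn; lia.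
    + move=> ? ? /memv_addP[u uU [_ /vlineP[a ->] ->]].
      move=> /memv_addP[v vU [_ /vlineP[b ->] ->]].
      rewrite linearDl !linearDr !linearZl_LR !linearZr_LR /=.
      by rewrite Uiso // Uy // yUa // phi_alt !scaler0 !addr0.
    + move=> ? w /memv_addP[u uU [_ /vlineP[a ->] ->]].
      rewrite memv_cap memv_ker lfunE /= => /andP[wA /eqP yw0].
      by rewrite linearDl linearZl_LR /= yw0 UA // scaler0 addr0.
  right; exists (A :\: U)%VS; first exact: subv_trans (diffvSl _ _) sAX.
  split=> [|y yAU y0].
    by have := dimv_cap_compl A U; rewrite (capv_idPr sUA); nia.
  rewrite leqNgt; apply/negP => rky; apply: no_y; exists y; split=> //.
    exact: subvP (diffvSl _ _) _ yAU.
  apply: contraNN y0 => yU.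
  by rewrite -memv0 -(capv_diff A U) memv_cap yAU.
- by right; exists Y => //; split=> //; lia.
Qed.

(* Quotienting by the span [E] of the products inside [C] decouples
   [phi (c1 + a *: v) (c2 + b *: v)]: modulo [E] it is
   [phi (b *: c1 - a *: c2) v]. *)
Lemma isotropic_or_anisotropic (F : fieldType) (vT zT : vectType F)
    (phi : {bilinear vT -> vT -> zT})
    (s t k : nat) (X : {vspace vT}) : (forall v, phi v v = 0) ->
    (0 < s)%N -> (k < t)%N -> (k.+1 * (s * t ^ 3) <= \dim X)%N ->
    (exists2 U : {vspace vT}, \dim U = s & isotropic phi U)
  \/ (exists C : {vspace vT}, exists E : {vspace zT},
       [/\ (C <= X)%VS, \dim C = k.+1, anisotropic phi C,
          {in C &, forall u v, phi u v \in E} & (\dim E <= \dim C ^ 2)%N]).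
Proof.
move=> phi_alt s_gt0; elim: k X => [|k IHk] X lt_kt dimX.
  right; exists <[vpick X]>%VS, 0%VS.
  have X0 : X != 0%VS.
    by rewrite -dimv_eq0 -lt0n (leq_trans _ dimX) // mul1n muln_gt0 s_gt0 expn_gt0 lt_kt.
  rewrite dim_vline vpick0 X0 dimv0 -memvE memv_pick; split=> //.
    move=> ? ? /vlineP[a ->] /vlineP[b ->] a0 _.
    have a_neq0: a != 0 by apply: contraNneq a0 => ->; rewrite scale0r.
    by apply/vlineP; exists (b / a); rewrite scalerA divfK.
  move=> ? ? /vlineP[a ->] /vlineP[b ->].
  by rewrite linearZl_LR linearZr_LR /= phi_alt !scaler0 mem0v.
have d_gt0 : (0 < t ^ 3)%N by rewrite expn_gt0; lia.
have [|[Y sYX [dimY rkY]]] := isotropic_or_high_rank X s phi_alt d_gt0.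
  by left.
have [||//|[C [E [sCY dimC Cani CE dimE]]]] := IHk Y; [lia | lia | by left | right].
(* The choice [d = t ^ 3] comes from here: with [\dim C = k.+1] and [\dim E <= k.+1 ^ 2], the rank
   needed is at most [k.+1 ^ 2 * k.+2 <= t ^ 3]. *)
have [c cC c0|v vX vC] := @exists_injective_product_mod _ _ _ _ phi C X E.
  apply: leq_trans (rkY c (subvP sCY c cC) c0); rewrite dimC in dimE *.
  have le3 : (k.+1 ^ 2 * k.+2 <= t ^ 2 * t)%N by rewrite leq_mul // leq_exp2r // ltnW.
  rewrite [(t ^ 3)%N]expnSr (leq_trans _ le3) // mulnS leq_add2l mulnC.
  by rewrite leq_mul.
have vNC : v \notin C.
  apply/negP => vC'; have v0 : v = 0 by apply: vC; rewrite ?phi_alt ?mem0v.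
  have := vpick0 C; rewrite (vC (vpick C)) ?memv_pick ?v0 ?linear0r ?mem0v //.
  by rewrite eqxx -dimv_eq0 dimC.
have skew := alternating_skew phi_alt.
exists (C + <[v]>)%VS, (E + linfun (applyr phi v) @: C)%VS.
have dimCv : \dim (C + <[v]>) = k.+2 by rewrite dim_addv_vline // dimC.
have phiE c1 c2 a b : phi (c1 + a *: v) (c2 + b *: v)
    = phi c1 c2 + phi (b *: c1 - a *: c2) v.
  rewrite linearBl linearDl !linearDr !linearZl_LR !linearZr_LR /=.
  by rewrite phi_alt !scaler0 addr0 (skew v c2) scalerN addrA.
rewrite dimCv; split=> //.
- by rewrite subv_add (subv_trans sCY sYX) -memvE.
- move=> ? ? /memv_addP[c1 c1C [_ /vlineP[a ->] ->]].
  move=> /memv_addP[c2 c2C [_ /vlineP[b ->] ->]] u0.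
  rewrite phiE => phi0.
  have bc_ac : b *: c1 - a *: c2 = 0.
    apply: vC; first by rewrite rpredB ?rpredZ.
    by rewrite -(rpredDl _ (CE _ _ c1C c2C)) phi0 mem0v.
  (* If [a != 0], the second vector is [b / a] times the first; if [a = 0], then [b = 0] because
     [c1 != 0], and both vectors lie in [C]. *)
  have [a0|a0] := eqVneq a 0; last first.
    apply/vlineP; exists (b / a); rewrite scalerDr scalerA divfK //; congr (_ + _).
    by rewrite mulrC -scalerA (subr0_eq bc_ac) scalerA mulVf ?scale1r.
  move: u0 bc_ac phi0; rewrite a0 !scale0r addr0 subr0 => c10 /eqP.
  rewrite scaler_eq0 (negPf c10) orbF => /eqP->.
  by rewrite !scale0r linear0l !addr0; apply: Cani.
- move=> ? ? /memv_addP[c1 c1C [_ /vlineP[a ->] ->]].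
  move=> /memv_addP[c2 c2C [_ /vlineP[b ->] ->]].
  rewrite phiE memv_add ?CE //.
  have -> z : phi z v = linfun (applyr phi v) z by rewrite lfunE.
  by rewrite memv_img ?rpredB ?rpredZ.
have := dimv_add_leqif E (linfun (applyr phi v) @: C)%VS => -[dimEv _].
have := limg_ker_dim (linfun (applyr phi v)) C; rewrite dimC in dimE *; nia.
Qed.

Theorem corollary4p4 (F : fieldType) (s t m n : nat)
    (hs : (2 <= s)%N) (ht : (2 <= t)%N) (hn : (s * t ^ 4 <= n)%N)
    (phi : {bilinear 'rV[F]_n -> 'rV[F]_n -> 'rV[F]_m})
    (hphi : alternating phi) :
  (exists W : {vspace 'rV[F]_n},
     \dim W = s /\ Gr W 2 `<=` hyperplane_section phi) \/
  (exists W : {vspace 'rV[F]_n},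
     \dim W = t /\ hyperplane_section phi `&` Gr W 2 = set0).
Proof.
(* The subspace found has dimension [k.+1], so [k] is taken one below the given dimension. *)
case: t ht hn => // t ht hn.
have [|||[W dimW Wiso]|[W [_ [_ dimW Wani _ _]]]] :=
  @isotropic_or_anisotropic _ _ _ phi s t.+1 t fullv hphi.
- exact: ltnW hs.
- exact: ltnSn.
- by rewrite dimvf /dim /= mul1n mulnCA -expnS.
- left; exists W; split=> // V [sVW dimV]; split=> [|u v uV vV].
    by split; rewrite ?subvf.
  by apply: Wiso; exact: subvP sVW _ _.
right; exists W; split=> //; rewrite -subset0 => V [[_ Viso] [sVW dimV]].
have V0 : V != 0%VS by rewrite -dimv_eq0 dimV.
(* An isotropic subspace of [W] lies on the line of any of its nonzero vectors, so it is not a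
   plane. *)
have /dimvS : (V <= <[vpick V]>)%VS.
  apply/subvP => v vV; apply: Wani; rewrite ?vpick0 ?(subvP sVW) ?memv_pick //.
  by rewrite Viso ?memv_pick.
by rewrite dim_vline vpick0 V0 dimV.
Qed.
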